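(* For every $n\ge 1$ and every $\pi\in S_n$, $\mathrm{cost}(\pi)\le \left\lceil \frac{n}{2}\right\rceil$.
   Context: Permutations are written in one-line notation; $S_n$ is the set of permutations of $[n]=\{1,\dots,n\}$, $id_n = 12\cdots n$, and $\varepsilon$ is the empty sequence. The device $\mathbb{Q}_{\mathrm{cuts}}^{\prime}$ processes configurations $(s_{inp},s_{dev},s_{out})$ of three sequences (input, content of the device, output), starting from $(\pi,\varepsilon,\varepsilon)$ and ending at $(\varepsilon,\varepsilon,\pi')$, using freely chosen operations: push (move the first element of the input to the end of $s_{dev}$); pop (move the first element of $s_{dev}$ to the end of the output); cut/shuffle (if $s_{dev}=s_1\cdots s_m$ with $m\ge2$, choose $k\in\{2,\dots,m\}$ and replace the content by $s_k s_{k+1}\cdots s_m s_1\cdots s_{k-1}$), where immediately after each cut the entire content of the device must be unloaded, i.e. appended in order to the output, leaving the device empty. Such a run is called an iteration, and $\mathbb{Q}_{\mathrm{cuts}}^{\prime}(\pi)$ denotes the set of all possible outputs $\pi'$ on input $\pi$. $(\mathbb{Q}_{\mathrm{cuts}}^{\prime})^{m}(\pi)$ is the set of permutations obtainable from $\pi$ by $m$ successive iterations (the output of each being the input of the next), with $(\mathbb{Q}_{\mathrm{cuts}}^{\prime})^{0}(\pi)=\{\pi\}$. Finally, $\mathrm{cost}(\pi)=\min\{m\ge 0 : id_n\in(\mathbb{Q}_{\mathrm{cuts}}^{\prime})^{m}(\pi)\}$ for $\pi\in S_n$; in particular $\mathrm{cost}(id_n)=0$. *)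

(* Defs.v *)
From Stdlib Require Import Relation_Operators.
From mathcomp Require Import all_boot all_fingroup.

Set Implicit Arguments.
Unset Strict Implicit.
Unset Printing Implicit Defensive.

Definition one_line n (p : 'S_n) : seq nat := [seq (p i : nat).+1 | i <- enum 'I_n].

Record config := Config { inp : seq nat; dev : seq nat; out : seq nat }.

(* The device must be emptied right after a cut, so a cut and the unloading
   that follows it form a single step; [rot k.-1 [:: s_1; ...; s_m]] is
   s_k ... s_m s_1 ... s_(k-1). *)
Inductive step : config -> config -> Prop :=
| Push x i d o : step (Config (x :: i) d o) (Config i (rcons d x) o)
| Pop x i d o : step (Config i (x :: d) o) (Config i d (rcons o x))
| Cut k i d o : 2 <= k <= size d ->
    step (Config i d o) (Config i [::] (o ++ rot k.-1 d)).

Definition Qcuts (s t : seq nat) : Prop :=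
  clos_refl_trans config step (Config s [::] [::]) (Config [::] [::] t).

Fixpoint Qcuts_iter (m : nat) (s t : seq nat) : Prop :=
  if m is m'.+1 then exists2 u, Qcuts_iter m' s u & Qcuts u t else t = s.

Definition sortable_in n (p : 'S_n) (m : nat) : Prop :=
  Qcuts_iter m (one_line p) (one_line (1%g : 'S_n)).

(* The cost is a minimum over a set whose nonemptiness needs proof, hence the
   relational form: [is_cost p c] reads "cost(p) is defined and equals c". *)
Definition is_cost n (p : 'S_n) (c : nat) : Prop :=
  sortable_in p c /\ forall m, sortable_in p m -> c <= m.

(* Main.v *)
Require Import Defs.
From Stdlib Require Import Relation_Operators Classical_Prop.
From mathcomp Require Import all_boot all_fingroup zify.

Set Implicit Arguments.
Unset Strict Implicit.
Unset Printing Implicit Defensive.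

(** A cut turns the segment [a ++ b] of the input lying in the device into
    [b ++ a], and everything else leaves in its order of arrival.  So one
    iteration may cut the word into consecutive segments and swap two adjacent
    blocks inside each of them, all in parallel ([Qcuts_round]).

    Call a factor x, x+1 of the word a bond at x.  A bond never has to be
    broken again, hence may be contracted to a single letter: sorting the
    shorter word, with the pair substituted back for the letter, sorts the
    original one in the same number of rounds ([rounds_contract]).  The bound
    follows by induction on the number of letters once a bond-free word on at
    least 4 letters is shown to gain two bonds in one round
    ([gains_two_reduced]); on 2 or 3 letters one bond per round suffices.

    To gain two bonds, suppose first that some x stands before x+2.  Wherever
    x+1 stands, two disjoint swaps make x, x+1, x+2 consecutive
    ([gains_two_triple]).  Otherwise x+2 always stands before x, so, on the
    letters 0, ..., k-1, the even letters appear in decreasing order and so do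
    the odd ones.  Let y be whichever of 0 and 1 comes first, and z the letter
    following it.  The larger letters of the parity of y stand left of y, so z
    has the other parity.  If z > y, then z > y + 1 as there is no bond; z-1
    stands left of y and y+1 right of z, so the word reads
    ... z-1 ... y z ... y+1 ..., and swapping the part from after z-1 up to y
    with the part from z up to before y+1 creates the bonds at z-1 and at y
    ([gains_two_cross]).  Otherwise y = 1, z = 0, and 1 0 is a factor with both
    2 and 3 to its left: swap 1 with 0, and bond 2 with 3 in the prefix. *)

(** * Rounds of adjacent block swaps *)

(** The blocks may be empty, so [RoundSwap] also covers segments left
    unchanged.  Polymorphism in the letters is what lets blocks be substituted
    for them. *)
Inductive round (T : Type) : seq T -> seq T -> Prop :=
| RoundNil : round [::] [::]
| RoundSwap a b s t : round s t -> round (a ++ b ++ s) (b ++ a ++ t).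

Lemma round_refl T (s : seq T) : round s s.
Proof. by have := RoundSwap [::] s (RoundNil T); rewrite !cats0. Qed.

Lemma round_swap T (a b : seq T) : round (a ++ b) (b ++ a).
Proof. by have := RoundSwap a b (RoundNil T); rewrite !cats0. Qed.

Lemma round_cat T (s1 t1 s2 t2 : seq T) :
  round s1 t1 -> round s2 t2 -> round (s1 ++ s2) (t1 ++ t2).
Proof.
move=> r1 r2; elim: r1 => [|a b s t _ IH] //=.
by rewrite -!catA; apply: RoundSwap.
Qed.

Lemma round_catl T (a s t : seq T) : round s t -> round (a ++ s) (a ++ t).
Proof. exact/round_cat/round_refl. Qed.

Lemma round_catr T (s t b : seq T) : round s t -> round (s ++ b) (t ++ b).
Proof. by move=> r; apply: round_cat r (round_refl b). Qed.

Lemma round_perm (T : eqType) (s t : seq T) : round s t -> perm_eq s t.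
Proof.
elim=> [|a b s' t' _ IH] //.
by rewrite !catA; apply: perm_cat IH; rewrite perm_catC.
Qed.

(** Substituting words for letters turns a swap of blocks into a swap of blocks,
    so a bond that has been contracted moves around as one letter. *)
Lemma round_subst T U (f : T -> seq U) s t :
  round s t -> round (flatten (map f s)) (flatten (map f t)).
Proof.
elim=> [|a b s' t' _ IH] /=; first exact: RoundNil.
by rewrite !map_cat !flatten_cat; apply: RoundSwap.
Qed.

Fixpoint rounds T (m : nat) (s t : seq T) : Prop :=
  if m is m'.+1 then exists2 u, round s u & rounds m' u t else s = t.

(** A round may leave the word unchanged, so rounds can be wasted. *)
Lemma rounds_le T m n (s t : seq T) : m <= n -> rounds m s t -> rounds n s t.
Proof.
move/subnK <-; elim: (n - m) => [|d IH] //= /IH r.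
by exists s; first exact: round_refl.
Qed.

Lemma rounds_subst T U (f : T -> seq U) m s t :
  rounds m s t -> rounds m (flatten (map f s)) (flatten (map f t)).
Proof.
elim: m s => [|m IH] s /=; first by move->.
by case=> u /(round_subst f) r /IH rs; exists (flatten (map f u)).
Qed.

(** * The device performs rounds *)

Local Notation reach := (clos_refl_trans config step).

Lemma reach_push a i d o :
  reach (Config (a ++ i) d o) (Config i (d ++ a) o).
Proof.
elim: a d => [|x a IH] d /=; first by rewrite cats0; apply: rt_refl.
apply: rt_trans (rt_step _ _ _ _ (Push _ _ _ _)) _.
by rewrite -cat_rcons; apply: IH.
Qed.

Lemma reach_pop a i o : reach (Config i a o) (Config i [::] (o ++ a)).
Proof.
elim: a o => [|x a IH] o /=; first by rewrite cats0; apply: rt_refl.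
apply: rt_trans (rt_step _ _ _ _ (Pop _ _ _ _)) _.
by rewrite -cat_rcons; apply: IH.
Qed.

(** Push [a ++ b] entirely and cut between the two blocks.  A cut leaves both
    parts nonempty; when a block is empty the device is simply popped. *)
Lemma reach_swap a b i o :
  reach (Config (a ++ b ++ i) [::] o) (Config i [::] (o ++ b ++ a)).
Proof.
rewrite catA; apply: rt_trans (reach_push _ _ _ _) _ => /=.
have [/andP[a0 b0]|] := boolP ((0 < size a) && (0 < size b)).
  have /(Cut i o) : 2 <= (size a).+1 <= size (a ++ b) by rewrite size_cat; lia.
  by rewrite /= rot_size_cat; apply: rt_step.
rewrite negb_and -!leqNgt !leqn0 !size_eq0.
by case/orP=> /eqP->; rewrite ?cats0; apply: reach_pop.
Qed.

Lemma Qcuts_round s t : round s t -> Qcuts s t.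
Proof.
suff gen o : round s t -> reach (Config s [::] o) (Config [::] [::] (o ++ t)).
  exact: (gen [::]).
move=> r; elim: r o => [|a b s' t' _ IH] o; first by rewrite cats0; apply: rt_refl.
apply: rt_trans (reach_swap _ _ _ _) _.
by have -> : o ++ b ++ a ++ t' = (o ++ b ++ a) ++ t' by rewrite -!catA.
Qed.

(** [Qcuts_iter] peels off the last iteration and [rounds] the first one. *)
Lemma Qcuts_iterSl m s u t :
  Qcuts s u -> Qcuts_iter m u t -> Qcuts_iter m.+1 s t.
Proof.
move=> su; elim: m t => [|m IH] t /= => [->|[v /IH sv vt]]; first by exists s.
by exists v.
Qed.

Lemma Qcuts_iter_rounds m s t : rounds m s t -> Qcuts_iter m s t.
Proof.
elim: m s => [|m IH] s /= => [->|[u /Qcuts_round su /IH ut]] //.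
exact: Qcuts_iterSl su ut.
Qed.

(** * Bonds and their contraction *)

Definition bond (x : nat) (w : seq nat) := infix [:: x; x.+1] w.

Lemma bondP x w : reflect (exists a b, w = a ++ x :: x.+1 :: b) (bond x w).
Proof. exact: (@infixP _ [:: x; x.+1]). Qed.

Lemma bond_mid a x b : bond x (a ++ x :: x.+1 :: b).
Proof. by apply/bondP; exists a, b. Qed.

(** Inverse to contraction: the letters above x make room for x+1, which comes
    back right after x. *)
Definition expand x (y : nat) := if y == x then [:: x; x.+1] else [:: bump x.+1 y].

Definition contract x (w : seq nat) := [seq unbump x.+1 y | y <- w & y != x.+1].

Lemma contract_cat x a b : contract x (a ++ b) = contract x a ++ contract x b.
Proof. by rewrite /contract filter_cat map_cat. Qed.

Lemma expandK x : cancel (fun v => flatten (map (expand x) v)) (contract x).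
Proof.
elim=> [|y v IH] //=; rewrite contract_cat IH /expand.
case: eqP => [->|_]; rewrite /contract /=.
  by rewrite eqxx /= (ltn_eqF (ltnSn x)) /= /unbump ltnNge leqnSn subn0.
by rewrite eq_sym neq_bump /= bumpK.
Qed.

Lemma contractK x w :
  uniq w -> bond x w -> flatten (map (expand x) (contract x w)) = w.
Proof.
move=> uw /bondP[a [b ew]]; move: uw.
have aux s : x \notin s -> x.+1 \notin s ->
    flatten (map (expand x) (contract x s)) = s.
  elim: s => [|y s IH] //=; rewrite !inE !negb_or => /andP[xy xs] /andP[x1y x1s].
  rewrite /contract /= eq_sym x1y /= -/(contract x s) IH //.
  have -> : expand x (unbump x.+1 y) = [:: y]; last by [].
  rewrite /expand ifN ?unbumpK ?inE 1?eq_sym //.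
  by apply/eqP; rewrite /unbump; lia.
rewrite {}ew cat_uniq /= !inE !negb_or => /and5P[_ /and3P[xa x1a _] /andP[_ xb] x1b _].
rewrite contract_cat map_cat flatten_cat aux //; congr (_ ++ _).
rewrite /contract /= eqxx (ltn_eqF (ltnSn x)) /= -/(contract x b) aux //.
by rewrite /unbump ltnNge leqnSn subn0 /expand eqxx.
Qed.

Lemma expand_iota x k :
  x < k -> flatten (map (expand x) (iota 0 k)) = iota 0 k.+1.
Proof.
move=> /subnKC <-; rewrite addSnnS -addnS !iotaD map_cat flatten_cat /=.
rewrite {2}/expand eqxx /= add0n; congr (_ ++ [:: _, _ & _]).
- rewrite -[RHS]flatten_seq1.
  congr flatten; apply/eq_in_map => y; rewrite mem_iota /= => yx.
  by rewrite /expand ltn_eqF // /bump leqNgt ltnS ltnW.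
- rewrite -[RHS]flatten_seq1 -(addn1 x.+1) addnC iotaDl -map_comp.
  congr flatten; apply/eq_in_map => y; rewrite mem_iota /= => /andP[xy _].
  by rewrite /expand gtn_eqF // /bump xy.
Qed.

(** A second bond survives the contraction of a larger one unchanged; for a bond
    above the contracted one the letters would be renumbered. *)
Lemma contract_bond x y w : y < x -> bond y w -> bond y (contract x w).
Proof.
move=> yx /bondP[a [b ->]]; rewrite contract_cat.
have -> : contract x [:: y, y.+1 & b] = [:: y, y.+1 & contract x b].
  rewrite /contract /= !ifT ?ltn_eqF //=; try by rewrite ltnS ltnW.
  by rewrite /unbump !ltnNge ltnW ?leqW // ltnW // !subn0.
exact: bond_mid.
Qed.

Lemma bond_lt x k w : perm_eq w (iota 0 k.+1) -> bond x w -> x < k.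
Proof.
move=> pw /bondP[a [b ew]].
have : x.+1 \in w by rewrite ew mem_cat !inE eqxx !orbT.
by rewrite (perm_mem pw) mem_iota /= ltnS.
Qed.

Lemma contract_perm x k w :
  perm_eq w (iota 0 k.+1) -> bond x w -> perm_eq (contract x w) (iota 0 k).
Proof.
move=> pw /(bond_lt pw) xk.
by rewrite -[iota 0 k](expandK x) expand_iota //; apply/perm_map/perm_filter.
Qed.

Lemma rounds_contract x k m w :
  perm_eq w (iota 0 k.+1) -> bond x w ->
  rounds m (contract x w) (iota 0 k) -> rounds m w (iota 0 k.+1).
Proof.
move=> pw xw /(rounds_subst (expand x)).
by rewrite contractK ?(perm_uniq pw) ?iota_uniq // expand_iota ?(bond_lt pw xw).
Qed.

(** * Gaining bonds in one round *)

Lemma index_split (w : seq nat) x y :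
  uniq w -> y \in w -> index x w < index y w ->
  exists a b c, w = a ++ x :: b ++ y :: c.
Proof.
move=> uw yw ixy.
have xw : x \in w by rewrite -index_mem (ltn_trans ixy) // index_mem.
case/splitPr: xw uw yw ixy => a b.
rewrite cat_uniq /= negb_or => /and3P[_ /andP[/negPf xa _] _].
rewrite mem_cat inE !index_cat xa /= eqxx addn0.
have [ya|_] /= := boolP (y \in a); first by rewrite ltnNge ltnW // index_mem.
rewrite (eq_sym x y); case: eqP => [_|_ /=]; first by rewrite addn0 ltnn.
by move=> yb _; case/splitPr: yb => b1 b2; exists a, b1, b2.
Qed.

Lemma mem_split2 (w : seq nat) x y :
  uniq w -> x \in w -> y \in w -> x != y ->
  (exists a b c, w = a ++ x :: b ++ y :: c) \/
  (exists a b c, w = a ++ y :: b ++ x :: c).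
Proof.
move=> uw xw yw xy; case: (ltngtP (index x w) (index y w)).
- by left; apply: index_split.
- by right; apply: index_split.
- by move=> e; rewrite -(nth_index 0 xw) e nth_index ?eqxx in xy.
Qed.

(** In both orders it is x that moves: rightwards past the letters before x+1,
    or leftwards past the block starting with x+1. *)
Lemma gain_one w x :
  uniq w -> x \in w -> x.+1 \in w -> exists2 w', round w w' & bond x w'.
Proof.
move=> uw xw x1w.
have [|[a [b [c ->]]]|[a [b [c ->]]]] := mem_split2 uw xw x1w.
- by rewrite ltn_eqF.
- exists (a ++ (b ++ [:: x]) ++ x.+1 :: c); last by rewrite -!catA catA; apply: bond_mid.
  have := round_catl a (round_catr (x.+1 :: c) (round_swap [:: x] b)).
  by rewrite /= -!catA.
- exists (a ++ (x :: x.+1 :: b) ++ c); last exact: bond_mid.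
  have := round_catl a (round_catr c (round_swap (x.+1 :: b) [:: x])).
  by rewrite /= -!catA.
Qed.

(** The order y < x only asks for two distinct bonds; stating it this way tells
    which one to contract first, see [contract_bond]. *)
Definition gains_two w :=
  exists2 w', round w w' & exists x y, [/\ y < x, bond x w' & bond y w'].

(** The letter x+1 stands before x, between x and x+2, or after x+2.  In each
    order two swaps of disjoint segments collect the three letters. *)
Lemma gains_two_triple w x :
  uniq w -> x.+1 \in w -> x.+2 \in w -> index x w < index x.+2 w ->
  gains_two w.
Proof.
move=> uw x1w x2w /(index_split uw x2w)[a [b [c ew]]].
suff [a' [c' r]] : exists a' c', round w (a' ++ [:: x, x.+1, x.+2 & c']).
  exists (a' ++ [:: x, x.+1, x.+2 & c']) => //.
  exists x.+1, x; split; rewrite ?ltnS //; last exact: bond_mid.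
  by rewrite -cat_rcons; apply: bond_mid.
move: x1w; rewrite {}ew mem_cat !inE (gtn_eqF (ltnSn x)) /= mem_cat inE.
rewrite (ltn_eqF (ltnSn _)) /= => /or3P[] /splitPr[p q].
- (* p [x+1 | q x] [b | x+2] c *)
  exists (p ++ q), (b ++ c).
  have := round_catl p (round_cat (round_swap [:: x.+1] (q ++ [:: x]))
    (round_catr c (round_swap b [:: x.+2]))).
  by rewrite /= -!catA /= -?catA.
- (* a [x | p] x+1 [q | x+2] c *)
  exists (a ++ p), (q ++ c).
  have := round_catl a (round_cat (round_swap [:: x] p)
    (round_catl [:: x.+1] (round_catr c (round_swap q [:: x.+2])))).
  by rewrite /= -!catA /= -?catA.
- (* a [x | b] [x+2 p | x+1] q *)
  exists (a ++ b), (p ++ q).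
  have := round_catl a (round_cat (round_swap [:: x] b)
    (round_catr q (round_swap (x.+2 :: p) [:: x.+1]))).
  by rewrite /= -!catA /= -?catA.
Qed.

(** Swapping [b y] with [x+1 c] closes two gaps at once: x+1 arrives just after
    x, and y just before y+1. *)
Lemma gains_two_cross a x b y c d :
  y < x -> gains_two (a ++ x :: b ++ y :: x.+1 :: c ++ y.+1 :: d).
Proof.
move=> yx; exists (a ++ x :: ((x.+1 :: c) ++ (rcons b y)) ++ y.+1 :: d).
  have := round_catl a (round_catl [:: x]
    (round_catr (y.+1 :: d) (round_swap (rcons b y) (x.+1 :: c)))).
  by rewrite /= -!catA !cat_rcons /= -?catA.
exists x, y; split=> //; first exact: bond_mid.
rewrite -catA cat_rcons.
by have := bond_mid (a ++ x :: x.+1 :: c ++ b) y d; rewrite -!catA /= -!catA.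
Qed.

Lemma index_same_parity k (f : nat -> nat) x y :
  (forall z, z.+2 < k -> f z.+2 < f z) ->
  x < y < k -> odd x = odd y -> f y < f x.
Proof.
move=> drop /andP[xy yk] par.
have [j e] : exists j, y = x + j.+1.*2 by exists (y - x)./2.-1; lia.
rewrite {}e {xy par} in yk *; elim: j yk => [|j IH] yk.
  by rewrite addn2; apply: drop; rewrite -addn2.
have e : x + j.+2.*2 = (x + j.+1.*2).+2 by lia.
by rewrite e in yk *; apply: ltn_trans (drop _ yk) (IH _); lia.
Qed.

Lemma mem_before (a c : seq nat) y z :
  uniq (a ++ y :: c) -> index z (a ++ y :: c) < index y (a ++ y :: c) -> z \in a.
Proof.
rewrite cat_uniq /= negb_or => /and3P[_ /andP[/negPf ya _] _].
rewrite !index_cat ya /= eqxx addn0.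
by case: ifP => // _; rewrite ltnNge leq_addr.
Qed.

Lemma mem_after (a c : seq nat) y z :
  uniq (a ++ y :: c) -> z \in a ++ y :: c ->
  index y (a ++ y :: c) < index z (a ++ y :: c) -> z \in c.
Proof.
rewrite cat_uniq /= negb_or => /and3P[_ /andP[/negPf ya _] _].
rewrite mem_cat !index_cat ya /= eqxx addn0 inE.
have [za _|_] /= := boolP (z \in a); first by rewrite ltnNge ltnW // index_mem.
by case: eqP => //= ->; rewrite eqxx addn0 ltnn.
Qed.

Lemma index_after (a c : seq nat) y z :
  uniq (a ++ y :: c) -> z \in c -> index y (a ++ y :: c) < index z (a ++ y :: c).
Proof.
rewrite cat_uniq /= negb_or => /and3P[_ /andP[/negPf ya ac] /andP[yc _]] zc.
rewrite !index_cat ya /= eqxx addn0 (negPf (hasPn ac z zc)).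
by case: eqP => [yz|_]; [rewrite yz zc in yc | rewrite -addn1 leq_add2l].
Qed.

(** [gains_two_cross] with the places of x and y+1 read off from indices. *)
Lemma gains_two_index a y x c w :
  w = a ++ y :: x.+1 :: c -> uniq w -> y < x -> y.+1 \in w ->
  index x w < index y w -> index x.+1 w < index y.+1 w -> gains_two w.
Proof.
move=> ew uw yx y1w ixy ix1y1.
have xa : x \in a by apply: (@mem_before a (x.+1 :: c) y); rewrite -ew.
have y1c : y.+1 \in c.
  by apply: (@mem_after (rcons a y) c x.+1); rewrite cat_rcons -ew.
rewrite {}ew {uw y1w ixy ix1y1}.
case/splitPr: xa => a1 a2; case/splitPr: y1c => c1 c2.
by have := gains_two_cross a1 a2 c1 c2 yx; rewrite /= -!catA /=.
Qed.

(** The heart of the argument, by the position of the smallest letters 0 and 1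
    in a shuffle of two decreasing sequences. *)
Lemma gains_two_reduced k w :
  3 < k -> perm_eq w (iota 0 k) -> (forall x, ~~ bond x w) -> gains_two w.
Proof.
move=> k3 pw red; have uw : uniq w by rewrite (perm_uniq pw) iota_uniq.
have mw z : (z \in w) = (z < k) by rewrite (perm_mem pw) mem_iota.
have [/existsP[x /andP[xk ix]]|/existsPn far] :=
  boolP [exists x : 'I_k, (x.+2 < k) && (index (x : nat) w < index x.+2 w)].
  by apply: gains_two_triple ix => //; rewrite mw // ltnW.
have drop z : z.+2 < k -> index z.+2 w < index z w.
  move=> zk; have zk' : z < k by lia.
  have := far (Ordinal zk'); rewrite /= zk /= -leqNgt leq_eqVlt => /predU1P[e|//].
  have z2w : z.+2 \in w by rewrite mw.
  have zw : z \in w by rewrite mw.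
  by have := nth_index 0 z2w; rewrite e nth_index //; lia.
have par x y : x < y < k -> odd x = odd y -> index y w < index x w.
  exact: (@index_same_parity k (index^~ w)).
have i01 : index 0 w != index 1 w.
  apply/eqP => e; have w0 : 0 \in w by rewrite mw; lia.
  have w1 : 1 \in w by rewrite mw; lia.
  by have := nth_index 0 w1; rewrite -e nth_index.
have adj a y z b c : w = a ++ y :: z :: b ++ c -> z < k /\ index y w < index z w.
  move=> ew; rewrite -mw; split; first by rewrite ew mem_cat !inE eqxx !orbT.
  by rewrite ew; apply: index_after; rewrite -?ew ?inE ?eqxx.
have [i0|i1] : index 0 w < index 1 w \/ index 1 w < index 0 w by lia.
- have [|a [b [c ew]]] := index_split uw _ i0; first by rewrite mw; lia.
  case: b ew => [|z b] ew.
    by case/negP: (red 0); rewrite ew; apply: bond_mid.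
  have [zk0 iz] := adj _ _ _ _ _ ew.
  have zodd : odd z.
    apply/negPn/negP => /negPf ze.
    have [z0|z0] := posnP z; first by rewrite z0 ltnn in iz.
    by have := par 0 z; rewrite z0 zk0 ze => /(_ isT erefl); lia.
  case: z => [|x] // in ew zk0 iz zodd *.
  have [x0|x0] := posnP x.
    by case/negP: (red 0); rewrite ew x0; apply: bond_mid.
  apply: (gains_two_index ew _ x0) => //; first by rewrite mw; lia.
    by apply: par; lia.
  by apply: par; lia.
- have [|a [b [c ew]]] := index_split uw _ i1; first by rewrite mw; lia.
  case: b ew => [|z b] ew.
    (* Here 1 0 is a factor, and 2 and 3 stand before it. *)
    have ew' : w = rcons a 1 ++ 0 :: c by rewrite cat_rcons.
    have a2 : 2 \in a.
      have : 2 \in rcons a 1.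
        by apply: (@mem_before _ c 0); rewrite -ew' //; apply: par; lia.
      by rewrite mem_rcons inE.
    have a3 : 3 \in a.
      by apply: (@mem_before _ (0 :: c) 1); rewrite -ew //; apply: par; lia.
    have ua : uniq a by move: uw; rewrite ew cat_uniq => /andP[].
    have [a' r /bondP[p [q ea]]] := gain_one ua a2 a3.
    exists (a' ++ [:: 0, 1 & c]).
      by rewrite ew; apply: round_cat r (round_catr c (round_swap [:: 1] [:: 0])).
    exists 2, 0; split=> //; last exact: bond_mid.
    by rewrite ea -catA /=; apply: bond_mid.
  have [zk0 iz] := adj _ _ _ _ _ ew.
  have zeven : ~~ odd z.
    apply/negP => zo.
    have [z1|z1] := leqP z 1.
      by have z1' : z = 1 by [lia]; rewrite z1' ltnn in iz.
    by have := par 1 z; rewrite z1 zk0 zo => /(_ isT erefl); lia.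
  have [z0|z0] := posnP z.
    rewrite z0 in ew.
    have := uw; rewrite ew cat_uniq /= mem_cat !inE eqxx !orbT.
    by rewrite !andbF.
  case: z => [|x] // in ew zk0 iz zeven z0 *.
  have [x1|x1] := leqP x 1.
    by case/negP: (red 1); rewrite ew (_ : x = 1); [apply: bond_mid | lia].
  apply: (gains_two_index ew _ x1) => //; first by rewrite mw; lia.
    by apply: par; lia.
  by apply: par; lia.
Qed.

(** * Sorting in half as many rounds as letters *)

Lemma bond_free_dec w : (exists x, bond x w) \/ (forall x, ~~ bond x w).
Proof.
have [/hasP[x _ xw]|/hasPn nw] := boolP (has (bond^~ w) w); first by left; exists x.
right=> x; apply/negP => xw; have /nw : x \in w; last by rewrite xw.
by case/bondP: xw => a [b ->]; rewrite mem_cat inE eqxx orbT.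
Qed.

(** The correction for k = 1, where no round is needed, is what makes the step
    from 2 letters to 1 fit the bound. *)
Lemma sort_rounds k w :
  perm_eq w (iota 0 k) -> rounds (uphalf k - (k == 1)) w (iota 0 k).
Proof.
have [m] := ubnP k; elim: m k w => // m IH k w km pw.
have uw : uniq w by rewrite (perm_uniq pw) iota_uniq.
have mw z : (z \in w) = (z < k) by rewrite (perm_mem pw) mem_iota.
have [k1|k1] := leqP k 1.
  have -> : w = iota 0 k; last exact: (@rounds_le _ 0).
  by case: k k1 {km mw} pw => [|[]] //= _ => [/perm_nilP|/perm_small_eq->].
case: k => // k in km pw mw k1 *.
have [[x xw]|red] := bond_free_dec w.
  apply: (rounds_contract pw xw).
  apply: (@rounds_le _ (uphalf k - (k == 1))); first by lia.
  by apply: IH; [lia | apply: contract_perm].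
have [k3|k3] := leqP k.+1 3.
  have [w' r xw'] : exists2 w', round w w' & bond 0 w'.
    by apply: gain_one; rewrite ?mw //; lia.
  have pw' : perm_eq w' (iota 0 k.+1) by rewrite -(permPl (round_perm r)).
  apply: (@rounds_le _ (uphalf k - (k == 1)).+1); first by lia.
  exists w' => //; apply: (rounds_contract pw' xw').
  by apply: IH; [lia | apply: contract_perm].
have [w' r [x [y [yx xw' yw']]]] := gains_two_reduced k3 pw red.
have pw' : perm_eq w' (iota 0 k.+1) by rewrite -(permPl (round_perm r)).
case: k => // k in km pw mw k1 k3 pw' *.
apply: (@rounds_le _ (uphalf k - (k == 1)).+1); first by lia.
have pc := contract_perm pw' xw'; have yc := contract_bond yx yw'.
exists w' => //; apply: (rounds_contract pw' xw'); apply: (rounds_contract pc yc).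
by apply: IH; [lia | apply: contract_perm].
Qed.

(** One-line notation uses the letters 1, ..., n, the words sorted above
    0, ..., n-1; the shift is again a substitution of words for letters. *)
Lemma sortable_uphalf n (p : 'S_n) : sortable_in p (uphalf n).
Proof.
apply/Qcuts_iter_rounds.
have word (q : 'S_n) : one_line q =
    flatten (map (fun y => [:: y.+1]) [seq val (q i) | i <- enum 'I_n]).
  by rewrite (map_comp (fun y => [:: y]) succn) flatten_seq1 -map_comp.
have word1 : [seq val ((1 : 'S_n)%g i) | i <- enum 'I_n] = iota 0 n.
  by rewrite -val_enum_ord; apply: eq_map => i; rewrite perm1.
rewrite !word word1; apply: rounds_subst.
apply: (@rounds_le _ (uphalf n - (n == 1))); first exact: leq_subr.
apply: sort_rounds; rewrite -val_enum_ord (map_comp val p).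
apply: perm_map; apply: uniq_perm => [||i].
- by rewrite (map_inj_uniq (@perm_inj _ p)) enum_uniq.
- exact: enum_uniq.
- by rewrite mem_enum -[i](permKV p) map_f ?mem_enum.
Qed.

(** Sortability in m iterations is not given as a decidable predicate, hence the
    classical case distinction. *)
Lemma least_witness (P : nat -> Prop) b :
  P b -> exists c, [/\ P c, forall m, P m -> c <= m & c <= b].
Proof.
have [m] := ubnP b; elim: m b => // m IH b bm Pb.
have [[d [Pd db]]|nP] := classic (exists d, P d /\ d < b).
  have [|c [Pc minc cd]] := IH d _ Pd; first by lia.
  by exists c; split=> //; lia.
exists b; split=> // d Pd; rewrite leqNgt; apply/negP => db.
by apply: nP; exists d.
Qed.

Theorem theorem4p2 (n : nat) (hn : 1 <= n) (p : 'S_n) :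
  exists c : nat, is_cost p c /\ c <= uphalf n.
Proof.
by have [c [Pc minc cb]] := least_witness (sortable_uphalf p); exists c.
Qed.
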